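(* Let $x<0$ and $y\in[b,+\infty)$, and define $\kappa^\star(y)=-\dfrac{v(0,y)}{\delta}$, where $v$ is the value function. Then $$v(x,y)=\begin{cases}0 & \text{if } x<\kappa^\star(y),\\ v(0,y)+\delta x & \text{if } \kappa^\star(y)<x<0.\end{cases}$$
   Context: Let $(\Omega,\mathcal F,\mathbb P)$ be a probability space with a complete right-continuous filtration $\mathbb F$. Fix constants $c,a,b,\eta,\rho>0$ and $\delta>1$. The claim sizes $(Y_k)_{k\ge1}$ are i.i.d. positive random variables with density $f$ and distribution function $F$, independent of the claim-counting process. For $y\ge b$, the claim-counting process $N=(N_t)_{t\ge0}$ is a Hawkes process with intensity $\lambda=(\lambda_t)_{t\ge 0}$ satisfying $d\lambda_t=a(b-\lambda_t)\,dt+\eta\,dN_t$, $\lambda_0=y$. The uncontrolled surplus is $R^x_t=x+ct-\sum_{k=1}^{N_t}Y_k$. A strategy is a pair $\alpha=(Z,K)$ (cumulative dividends, cumulative capital injections), and the controlled surplus is $X_t=R^x_t-Z_t+K_t$, with $X_{0^-}=x$. For $(x,y)\in\mathbb R\times[b,+\infty)$, the set $\mathcal A(x,y)$ of admissible strategies (for initial state $(X_0,\lambda_0)=(x,y)$) consists of those $\alpha$ such that: $Z$ is right-continuous with left limits, $\mathbb F$-adapted, non-decreasing, $Z_{0^-}=0$ and $Z_t-Z_{t^-}\le (X_{t^-}+R^0_t-R^0_{t^-})^+$ for all $t$; and $K$ is left-continuous with right limits, $\mathbb F$-adapted, non-decreasing, $K_{0^-}=0$. The ruin time is $T^\alpha=\inf\{t\ge0: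 X_{t^+}<0\}$. The reward and the value function are $$J_\alpha(x,y)=\mathbb E\Big[\int_0^{T^\alpha}e^{-\rho s}\,dZ_s-\delta\int_0^{T^\alpha}e^{-\rho s}\,dK_s\Big],\qquad v(x,y)=\sup_{\alpha\in\mathcal A(x,y)}J_\alpha(x,y),$$ where the integrals include lump-sum payments and injections made at time $0$.
   Formalization: The formal statement also assumes that the initial sigma-field F_0 is trivial (events of probability 0 or 1) and that the surplus is adapted; without trivial F_0 the formula can fail, e.g. if F_0 contains the first claim size Y_1. *)

(* Defs.v *)
From HB Require Import structures.
From mathcomp Require Import all_boot all_order all_algebra.
From mathcomp Require Import all_classical all_reals all_analysis.

Set Implicit Arguments.
Unset Strict Implicit.
Unset Printing Implicit Defensive.

Import Order.TTheory GRing.Theory Num.Theory.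
Import numFieldNormedType.Exports.

Local Open Scope classical_set_scope.
Local Open Scope ring_scope.

                                                                             
                                                                            
                                                                          

Definition leftlim (R : realType) (g : R -> R) (t : R) : R :=
  lim (g s @[s --> t^'-]).

Definition rightlim (R : realType) (g : R -> R) (t : R) : R :=
  lim (g s @[s --> t^'+]).

Definition cumulative_of (R : realType) (g : R -> R)
    (H : {homo g : s t / s <= t} /\ right_continuous g) : cumulative R R :=
  HB.pack_for (cumulative R R) g (isCumulative.Build R _ R g H.1 H.2).

                                                                           
                                                                                
Definition stieltjes_integral (R : realType) (g : R -> R) (D : set R)
    (h : R -> R) : \bar R :=
  match pselect ({homo g : s t / s <= t} /\ right_continuous g) with
  | left H => \int[lebesgue_stieltjes_measure (cumulative_of H)]_(s in D) (h s)%:E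
  | right _ => 0%E
  end.

Section filtered_space.
Context (R : realType) (d : measure_display) (Omega : measurableType d)
  (P : probability Omega R).

                                           
Record complete_right_continuous_filtration (Ft : R -> set (set Omega)) : Prop := {
  filtration_sigma_algebra : forall t, 0 <= t -> sigma_algebra setT (Ft t) ;
  filtration_measurable : forall t, 0 <= t -> Ft t `<=` measurable ;
  filtration_nondecreasing : forall s t, 0 <= s -> s <= t -> Ft s `<=` Ft t ;
  filtration_complete : forall t, 0 <= t -> P.-negligible `<=` Ft t ;
  filtration_right_continuous : forall t A, 0 <= t ->
    (forall s, t < s -> Ft s A) -> Ft t A }.

Definition adapted (Ft : R -> set (set Omega)) (X : R -> Omega -> R) : Prop :=
  forall t, 0 <= t -> forall B : set R, measurable B -> Ft t (X t @^-1` B).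

Record martingale (Ft : R -> set (set Omega)) (M : R -> Omega -> R) : Prop := {
  martingale_adapted : adapted Ft M ;
  martingale_integrable : forall t, 0 <= t -> P.-integrable setT (EFin \o M t) ;
  martingale_condexp : forall s t A, 0 <= s -> s <= t -> Ft s A ->
    (\int[P]_(w in A) (M t w)%:E = \int[P]_(w in A) (M s w)%:E)%E }.

                                                  
Definition sigma_of (I : Type) (e : measure_display) (T : measurableType e)
    (X : I -> Omega -> T) : set (set Omega) :=
  <<s [set A | exists i (B : set T), measurable B /\ A = X i @^-1` B] >>.

Record counting_process (N : R -> Omega -> nat) : Prop := {
  counting_le0 : forall t w, t <= 0 -> N t w = 0%N ;
  counting_nondecreasing : forall s t w, s <= t -> (N s w <= N t w)%N ;
  counting_right_continuous : forall w, right_continuous (fun t => (N t w)%:R : R) ;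
  counting_unit_jumps : forall t w, \forall s \near t^'-, (N t w <= (N s w).+1)%N }.

                                                                              
                                                                           
Record hawkes_process (Ft : R -> set (set Omega)) (a b eta y : R)
    (N : R -> Omega -> nat) (lam : R -> Omega -> R) : Prop := {
  hawkes_counting : counting_process N ;
  hawkes_adapted : adapted Ft (fun t w => (N t w)%:R) ;
  hawkes_intensity_integrable : forall t w, 0 <= t ->
    lebesgue_measure.-integrable `[0, t] (EFin \o (fun s => lam s w)) ;
  hawkes_sde : forall t w, 0 <= t ->
    lam t w = y
      + Rintegral lebesgue_measure `[0, t] (fun s => a * (b - lam s w))
      + eta * (N t w)%:R ;
  hawkes_intensity : martingale Ft (fun t w =>
    (N t w)%:R - Rintegral lebesgue_measure `[0, t] (fun s => lam s w)) }.

                                                                                  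
Record claim_sizes (f F : R -> R) (N : R -> Omega -> nat)
    (Y : nat -> {RV P >-> R}) : Prop := {
  claim_positive : forall k w, 0 < Y k w ;
  claim_density_measurable : measurable_fun setT f ;
  claim_density_ge0 : forall z, 0 <= f z ;
  claim_density : forall k (B : set R), measurable B ->
    (distribution P (Y k) B = \int[lebesgue_measure]_(z in B) (f z)%:E)%E ;
  claim_cdf : forall k z, cdf (Y k) z = (F z)%:E ;
  claim_independent : forall (n : nat) (B : nat -> set R),
    (forall k, measurable (B k)) ->
    (P (\big[setI/setT]_(k < n) (Y k @^-1` B k))
     = \prod_(k < n) P (Y k @^-1` B k))%E ;
  claim_independent_counting : forall A B : set Omega,
    sigma_of (fun k => Y k : Omega -> R) A -> sigma_of N B ->
    (P (A `&` B) = P A * P B)%E }.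

Section control.
Variables (Ft : R -> set (set Omega)) (c rho delta : R)
  (N : R -> Omega -> nat) (Y : nat -> {RV P >-> R}).

Definition uncontrolled_surplus (x t : R) (w : Omega) : R :=
  x + c * Num.max 0 t - \sum_(k < N t w) Y k w.

                                                                             
Definition strategy : Type := ((R -> Omega -> R) * (R -> Omega -> R))%type.

Definition controlled_surplus (x : R) (alpha : strategy) (t : R) (w : Omega) : R :=
  uncontrolled_surplus x t w - alpha.1 t w + alpha.2 t w.

Record admissible (x : R) (alpha : strategy) : Prop := {
  dividend_adapted : adapted Ft alpha.1 ;
  dividend_lt0 : forall t w, t < 0 -> alpha.1 t w = 0 ;
  dividend_nondecreasing : forall w, {homo alpha.1^~ w : s t / s <= t} ;
  dividend_right_continuous : forall w, right_continuous (alpha.1^~ w) ;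
  dividend_left_limits : forall t w, cvg (alpha.1 s w @[s --> t^'-]) ;
  dividend_jump : forall t w, 0 <= t ->
    alpha.1 t w - leftlim (alpha.1^~ w) t
    <= Num.max 0 (leftlim (controlled_surplus x alpha ^~ w) t
                  + uncontrolled_surplus 0 t w
                  - leftlim (uncontrolled_surplus 0 ^~ w) t) ;
  injection_adapted : adapted Ft alpha.2 ;
  injection_lt0 : forall t w, t < 0 -> alpha.2 t w = 0 ;
  injection_nondecreasing : forall w, {homo alpha.2^~ w : s t / s <= t} ;
  injection_left_continuous : forall t w, alpha.2 s w @[s --> t^'-] --> alpha.2 t w ;
  injection_right_limits : forall t w, cvg (alpha.2 s w @[s --> t^'+]) }.

                               
Definition ruin_time (x : R) (alpha : strategy) (w : Omega) : \bar R :=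
  ereal_inf [set t%:E | t in
    [set t : R | 0 <= t /\ rightlim (controlled_surplus x alpha ^~ w) t < 0]].

                                                       
Definition until_ruin (x : R) (alpha : strategy) (w : Omega) : set R :=
  [set s : R | 0 <= s /\ (s%:E <= ruin_time x alpha w)%E].

                                                                         
                                                                              
                                                                               
                                                                                
Definition reward (x : R) (alpha : strategy) : \bar R :=
  (\int[P]_w
     (stieltjes_integral (alpha.1^~ w) (until_ruin x alpha w)
        (fun s => expR (- (rho * s)))
      - delta%:E
        * stieltjes_integral (rightlim (alpha.2^~ w)) (until_ruin x alpha w)
            (fun s => expR (- (rho * s)))))%E.

                                                             
Definition value_function (x : R) : \bar R :=
  ereal_sup [set reward x alpha | alpha in admissible x].

Definition kappa_star : \bar R := (- (value_function 0%R * (delta^-1)%:E))%E.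

End control.
End filtered_space.

(* Main.v *)
Require Import Defs.
From HB Require Import structures.
From mathcomp Require Import all_boot all_order all_algebra.
From mathcomp Require Import all_classical all_reals all_analysis.
From mathcomp Require Import measurable_realfun ring lra.

Set Implicit Arguments.
Unset Strict Implicit.
Unset Printing Implicit Defensive.

Import Order.TTheory GRing.Theory Num.Theory.
Import numFieldNormedType.Exports.

Local Open Scope classical_set_scope.
Local Open Scope ring_scope.

(** Write K(0+) for the injection made at time 0. Everything follows from the
identity v(x) = max(0, v(0) + delta * x) for x < 0, lemma [value_lt0].

Injecting the missing amount -x at time 0 and then following a strategy for
the reserve 0 produces the same surplus after time 0, the same dividends and
the same ruin time as that strategy, at the extra cost -delta * x. Hence
v(x) >= v(0) + delta * x, while doing nothing gives v(x) >= 0. Conversely take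
any strategy from x. The event K(0+) < -x belongs to the right-continuous
filtration at time 0, whose events have probability 0 or 1
([initial_injection_zero_one]). If it has probability 1, ruin is immediate;
no dividend can be paid from a nonpositive reserve, so the reward is at most 0
([reward_immediate]). If it has probability 0, subtracting -x from the
injections gives a strategy for the reserve 0 whose reward is larger by exactly
-delta * x ([reward_shift]). Both directions use one transformation of
strategies, [shift_injection].

The two analytic points are the following. Removing an amount from the initial
injection changes the Stieltjes measure of the injections by a Dirac mass at 0
([stieltjes_integral_jump]). The pathwise identity passes to expectations by
[integral_cstD], which covers rewards whose positive or negative part is not
integrable but needs the pathwise payoff to be measurable
([payoff_measurable]). Measurability comes from writing Stieltjes integrals of
left-continuous integrands as limits of left Riemann sums
([left_riemann_sum_cvg]). *)

(** * One-sided limits of nondecreasing functions *)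

Section one_sided_limits.
Context {R : realType}.
Implicit Types (f g : R -> R) (s t : R).

Lemma near_eq_leftlim f g t :
  (\forall s \near t^'-, f s = g s) -> leftlim f t = leftlim g t.
Proof.
move=> fg; rewrite /leftlim; congr (lim _); rewrite eqEsubset; split.
  exact: near_eq_cvg.
by apply: near_eq_cvg; apply: filterS fg => s ->.
Qed.

Lemma near_eq_rightlim f g t :
  (\forall s \near t^'+, f s = g s) -> rightlim f t = rightlim g t.
Proof.
move=> fg; rewrite /rightlim; congr (lim _); rewrite eqEsubset; split.
  exact: near_eq_cvg.
by apply: near_eq_cvg; apply: filterS fg => s ->.
Qed.

Lemma leftlim_near_cst f t x :
  (\forall s \near t^'-, f s = x) -> leftlim f t = x.
Proof. by move=> /(near_eq_leftlim (g := cst x)) ->; exact: lim_cst. Qed.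

Lemma rightlim_near_cst f t x :
  (\forall s \near t^'+, f s = x) -> rightlim f t = x.
Proof. by move=> /(near_eq_rightlim (g := cst x)) ->; exact: lim_cst. Qed.

Lemma nondecreasing_cvg_at_left f t :
  {homo f : x y / x <= y} -> cvg (f s @[s --> t^'-]).
Proof.
move=> ndf; apply: nondecreasing_at_left_is_cvgr.
  by near=> s => x y _ _; exact: ndf.
near=> s; exists (f t) => _ /= [y + <-]; rewrite in_itv/= => /andP[_ yt].
exact/ndf/ltW.
Unshelve. all: by end_near. Qed.

Lemma nondecreasing_cvg_at_right f t :
  {homo f : x y / x <= y} -> cvg (f s @[s --> t^'+]).
Proof.
move=> ndf; apply: nondecreasing_at_right_is_cvgr.
  by near=> s => x y _ _; exact: ndf.
near=> s; exists (f t) => _ /= [y + <-]; rewrite in_itv/= => /andP[ty _].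
exact/ndf/ltW.
Unshelve. all: by end_near. Qed.

Section nondecreasing.
Variable f : R -> R.
Hypothesis ndf : {homo f : x y / x <= y}.

Lemma rightlim_ge t : f t <= rightlim f t.
Proof.
apply: limr_ge; first exact: nondecreasing_cvg_at_right.
by near=> s; apply/ndf; near: s; exact: nbhs_right_ge.
Unshelve. all: by end_near. Qed.

Lemma rightlim_le s t : s < t -> rightlim f s <= f t.
Proof.
move=> st; apply: limr_le; first exact: nondecreasing_cvg_at_right.
by near=> u; apply/ndf; near: u; exact: nbhs_right_le.
Unshelve. all: by end_near. Qed.

Lemma rightlim_homo : {homo rightlim f : x y / x <= y}.
Proof.
move=> s t; rewrite le_eqVlt => /predU1P[->//|st].
exact: le_trans (rightlim_le st) (rightlim_ge t).
Qed.

(** If [t < s < u] then [f(t+) <= f(s+) <= f(u)], so the closeness of [f(u)] to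
[f(t+)] is inherited by [f(s+)]. *)
Lemma rightlim_right_continuous : right_continuous (rightlim f).
Proof.
move=> t; apply/cvgrPdist_le => e e0.
have /cvgrPdist_le/(_ e e0) : f s @[s --> t^'+] --> rightlim f t.
  exact: nondecreasing_cvg_at_right.
move=> [r /= r0 h]; exists r => // s /= tsr ts.
rewrite ler0_norm ?opprB; last by rewrite subr_le0; exact/rightlim_homo/ltW.
(* [u] is the midpoint of [s] and of the end [t + r] of the neighbourhood. *)
pose u := s + (r - (s - t)) / 2.
have str : s - t < r by rewrite -(gtr0_norm (_ : 0 < s - t)) ?subr_gt0// distrC.
have su : s < u by rewrite /u ltrDl; lra.
apply: (@le_trans _ _ (f u - rightlim f t)); first by rewrite lerB// rightlim_le.
apply: le_trans (ler_norm _) _; rewrite distrC; apply: h => /=; last exact: lt_trans su.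
rewrite ltr0_norm /u; lra.
Qed.

End nondecreasing.

Lemma cvg_rightlim_sequence f t : cvg (f s @[s --> t^'+]) ->
  f (t + n.+1%:R^-1) @[n --> \oo] --> rightlim f t.
Proof.
move=> /cvg_at_rightP; apply; split=> [n|]; first by rewrite ltrDl invr_gt0.
rewrite -[X in _ --> X]addr0; apply: cvgD; first exact: cvg_cst.
exact: cvg_harmonic.
Qed.

End one_sided_limits.

(** * Stieltjes integrals *)

Section stieltjes.
Context {R : realType}.
Implicit Types (g h : R -> R) (mu : cumulative R R).

Lemma stieltjes_measure_itvoc mu a b : a <= b ->
  lebesgue_stieltjes_measure mu `]a, b] = (mu b - mu a)%:E.
Proof.
move=> ab; rewrite /lebesgue_stieltjes_measure /measure_extension.
by rewrite measurable_mu_extE/= ?wlength_itv_bnd//; exact: is_ocitv.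
Qed.

Lemma stieltjes_measure_itvoc0 mu a b : mu a = mu b ->
  lebesgue_stieltjes_measure mu `]a, b] = 0%E.
Proof.
move=> mab; have [ab|ba] := leP a b.
  by rewrite stieltjes_measure_itvoc// mab subrr.
by rewrite set_itv_ge ?measure0// bnd_simp -leNgt ltW.
Qed.

(** The negative half-line is a countable union of intervals at whose two end
points [mu] takes the same value 0. *)
Lemma stieltjes_measure_lt0 mu : (forall t, t < 0 -> mu t = 0) ->
  lebesgue_stieltjes_measure mu `]-oo, 0[ = 0%E.
Proof.
move=> mu0; pose F n : set R := `]- n.+2%:R, - n.+1%:R^-1]%classic.
have FI : `]-oo, 0[%classic `<=` \bigcup_n F n.
  move=> t /=; rewrite in_itv/= => t0.
  have [n [tn nt]] : exists n : nat, - t < n.+2%:R /\ n.+1%:R^-1 <= - t.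
    exists (maxn (Num.truncn (- t)) (Num.truncn (- t)^-1)); split.
      rewrite (lt_le_trans (truncnS_gt _))// ler_nat.
      by rewrite ltnS leqW ?leq_maxl.
    rewrite invf_ple ?posrE ?ltr0n ?oppr_gt0//.
    rewrite (le_trans (ltW (truncnS_gt _)))// ler_nat.
    by rewrite ltnS leq_maxr.
  by exists n => //; rewrite /F/= in_itv/= ltrNl tn lerNr.
have NF : (lebesgue_stieltjes_measure mu).-negligible (\bigcup_n F n).
  apply: negligible_bigcup => n; apply/negligibleP; first exact: measurable_itv.
  by apply: stieltjes_measure_itvoc0; rewrite !mu0// oppr_lt0 ?invr_gt0.
apply: (@measure_negligible _ (measurableTypeR R)); first exact: measurable_itv.
exact: (@negligibleS _ (measurableTypeR R) _ _ _ _ FI NF).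
Qed.

Lemma stieltjes_integralE g D h (H : {homo g : s t / s <= t} /\ right_continuous g) :
  stieltjes_integral g D h =
  (\int[lebesgue_stieltjes_measure (cumulative_of H)]_(s in D) (h s)%:E)%E.
Proof.
rewrite /stieltjes_integral; case: pselect => [H'|//].
by rewrite (Prop_irrelevance H H').
Qed.

Lemma stieltjes_integral_ge0 g D h : (forall s, 0 <= h s) ->
  (0 <= stieltjes_integral g D h)%E.
Proof.
move=> h0; rewrite /stieltjes_integral; case: pselect => // H.
by apply: integral_ge0 => s _; rewrite lee_fin.
Qed.

(** The measure of [{s}] is at most that of the half-open interval from [t] to [s],
which is 0. *)
Lemma stieltjes_integral_set1 g t s h : t < s -> g t = g s ->
  stieltjes_integral g [set s] h = 0%E.
Proof.
move=> ts gts; rewrite /stieltjes_integral; case: pselect => // H.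
apply: null_set_integral.
- exact: measurable_set1.
- exact: measurable_fun_set1.
apply/eqP; rewrite -measure_le0.
rewrite -(@stieltjes_measure_itvoc0 (cumulative_of H) t s)//.
rewrite le_measure ?inE//.
by move=> _ ->; rewrite /= in_itv/= ts lexx.
Qed.

(** The Stieltjes measure of [g'] is that of [g] plus [k] times the Dirac mass at
0, since both measures agree on the intervals open on the left and closed on
the right. *)
Lemma stieltjes_integral_jump g g' (k : R) (D : set R) h : 0 <= k ->
  {homo g : s t / s <= t} -> right_continuous g ->
  (forall t, t < 0 -> g' t = g t) -> (forall t, 0 <= t -> g' t = g t + k) ->
  measurable D -> D 0 -> measurable_fun setT h -> (forall s, 0 <= h s) ->
  stieltjes_integral g' D h = (stieltjes_integral g D h + (k * h 0)%:E)%E.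
Proof.
move=> k0 ndg rcg gN gP mD D0 mh h0.
have H' : {homo g' : s t / s <= t} /\ right_continuous g'.
  split=> [s t st|t].
    have := ndg _ _ st; have [s0|s0] := ltP s 0; have [t0|t0] := ltP t 0.
    - by rewrite !gN.
    - by rewrite gN// gP// => /le_trans; apply; rewrite lerDl.
    - by have := lt_le_trans t0 s0; rewrite ltNge st.
    - by rewrite !gP// lerD2r.
  have [t0|t0] := ltP t 0.
    rewrite gN//; apply: cvg_trans (rcg t); apply: near_eq_cvg.
    by near=> s; rewrite gN//; near: s; exact: nbhs_right_lt.
  rewrite gP//; apply: cvg_trans (cvgD (rcg t) (cvg_cst k)).
  apply: near_eq_cvg; near=> s; rewrite gP//; apply: le_trans t0 _.
  by near: s; exact: nbhs_right_ge.
pose H := conj ndg rcg; rewrite (stieltjes_integralE _ _ H) (stieltjes_integralE _ _ H').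
pose m := lebesgue_stieltjes_measure (cumulative_of H).
pose dk := mscale (NngNum k0) (\d_(0 : measurableTypeR R)).
have mhD : measurable_fun (D : set (measurableTypeR R))
  (EFin \o h : measurableTypeR R -> \bar R).
  by apply/measurable_EFinP; exact: measurable_funS mh.
transitivity (\int[measure_add m dk]_(s in D) (h s)%:E)%E.
  apply: eq_measure_integral => A mA _.
  apply: lebesgue_stieltjes_measure_unique => // _ [[a b] _ <-].
  rewrite [(a, b).1]/= [(a, b).2]/=.
  have [ab|ba] := leP a b; last first.
    by rewrite set_itv_ge ?measure0// bnd_simp -leNgt ltW.
  transitivity (m `]a, b]%classic + dk `]a, b]%classic)%E; last first.
    exact/esym/measure_addE.
  rewrite /m /dk !stieltjes_measure_itvoc// /mscale/= diracE -EFinM -EFinD.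
  congr (_%:E); rewrite mem_setE in_itv/=.
  (* The interval contains 0 exactly when [a < 0 <= b]. *)
  have [a0|a0] := ltP a 0; have [b0|b0] := leP 0 b => /=.
  - by rewrite gP// gN// mulr1 addrAC.
  - by rewrite gN// gN// mulr0 addr0.
  - by rewrite !gP// mulr0; lra.
  - by have := lt_le_trans b0 a0; rewrite ltNge ab.
rewrite ge0_integral_measure_add//; last by move=> s _; rewrite lee_fin.
congr (_ + _)%E; rewrite ge0_integral_mscale//; last by move=> s _; rewrite lee_fin.
by rewrite integral_dirac// diracE mem_set// mul1e EFinM.
Unshelve. all: by end_near. Qed.

End stieltjes.

(** * Left Riemann sums and measurable dependence on a parameter *)

Section stieltjes_riemann_sum.
Context {R : realType}.
Variables (mu : cumulative R R) (psi : R -> R) (a : R) (L : nat).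
Hypotheses (psi0 : forall s, 0 <= psi s)
  (psi_ni : {homo psi : s t / s <= t >-> t <= s})
  (psi_left : forall t, psi s @[s --> t^'-] --> psi t).

Let p (n k : nat) : R := a + k%:R / n.+1%:R.

Definition left_riemann_sum (n : nat) : R :=
  \sum_(k < L * n.+1) psi (p n k) * (mu (p n k.+1) - mu (p n k)).

Let p_homo n : {homo p n : j k / (j <= k)%N >-> j <= k}.
Proof. by move=> j k jk; rewrite /p lerD2l ler_pM2r ?invr_gt0// ler_nat. Qed.

Let pL n : p n (L * n.+1) = a + L%:R.
Proof. by rewrite /p natrM mulfK// pnatr_eq0. Qed.

(* The step function whose integral is the Riemann sum. *)
Let step n (s : R) : R :=
  \sum_(k < L * n.+1) psi (p n k) * \1_(`]p n k, p n k.+1]) s.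

Let stepE n s : s \in `]a, a + L%:R] ->
  exists k, [/\ step n s = psi (p n k), p n k < s & s <= p n k + n.+1%:R^-1].
Proof.
rewrite in_itv/= => /andP[as_ sL].
(* The last grid point strictly before [s] is the predecessor of the first grid
point that is at least [s]. *)
have ex : exists k, s <= p n k by exists (L * n.+1)%N; rewrite pL.
case: (ex_minnP ex) => -[|k] sk min_k.
  by move: sk; rewrite /p mul0r addr0 leNgt as_.
have ks : p n k < s by rewrite ltNge; apply/negP => /min_k; rewrite ltnn.
have kL : (k < L * n.+1)%N.
  by rewrite ltnNge; apply/negP => /(p_homo n); rewrite pL leNgt (lt_le_trans ks).
exists k; split => //; last by rewrite (le_trans sk)// /p -addrA -natr1 mulrDl mul1r.
rewrite /step (bigD1 (Ordinal kL))//= big1 ?addr0.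
  by rewrite indicE mem_set ?mulr1//= in_itv/= ks.
move=> j /eqP jk; rewrite indicE memNset ?mulr0//= in_itv/= => /andP[js sj].
have [jk'|kj] := ltnP j k.
  by have := le_lt_trans (p_homo n jk') ks; rewrite ltNge sj.
move: kj; rewrite leq_eqVlt => /predU1P[kj|kj]; first by apply: jk; apply: val_inj.
by have := lt_le_trans js sk; rewrite ltNge p_homo.
Qed.

(** The step functions evaluate [psi] at a grid point which tends to [s] from
the left, so they converge to [psi] pointwise by left-continuity, and they are
dominated by [psi a] by monotonicity. *)
Lemma left_riemann_sum_cvg :
  (left_riemann_sum n)%:E @[n --> \oo] -->
  (\int[lebesgue_stieltjes_measure mu]_(s in `]a, (a + L%:R)%R]) (psi s)%:E)%E.
Proof.
set I := `]a, a + L%:R]%classic.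
have mI : measurable (I : set (measurableTypeR R)) by exact: measurable_itv.
have mpsi : measurable_fun (I : set (measurableTypeR R)) (fun s => (psi s)%:E).
  by apply/measurable_EFinP; exact: nonincreasing_measurable.
have mstep n : measurable_fun (I : set (measurableTypeR R)) (fun s => (step n s)%:E).
  apply/measurable_EFinP; apply: measurable_sum => k.
  exact: measurable_funM.
have -> : (fun n => (left_riemann_sum n)%:E) =
    (fun n => \int[lebesgue_stieltjes_measure mu]_(s in I) (step n s)%:E)%E.
  apply/funext => n.
  under eq_integral do rewrite /step -sumEFin.
  rewrite ge0_integral_sum//; last 2 first.
  - by move=> k; apply/measurable_EFinP; exact: measurable_funM.
  - by move=> k s _; rewrite lee_fin mulr_ge0.
  rewrite /left_riemann_sum -sumEFin; apply: eq_bigr => k _.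
  under eq_integral do rewrite EFinM.
  rewrite ge0_integralZl//; last 2 first.
  - exact/measurable_EFinP.
  - by rewrite lee_fin.
  rewrite integral_indic//.
  rewrite setIidl; first by rewrite [X in (_ * X)%E]stieltjes_measure_itvoc ?p_homo.
  move=> s /=; rewrite !in_itv/= => /andP[ks sk]; apply/andP; split.
    by apply: le_lt_trans ks; rewrite /p lerDl mulr_ge0// invr_ge0.
  by apply: (le_trans sk); rewrite -(pL n); exact: p_homo.
have [|||_ _ //] := @dominated_convergence _ _ _ (lebesgue_stieltjes_measure mu) I mI
  (fun n s => (step n s)%:E) (fun s => (psi s)%:E) (cst (psi a)%:E) mstep mpsi.
- apply: aeW => s sI; apply/cvg_EFin; first by near=> n.
  apply/cvgrPdist_le => e e0.
  have /cvgrPdist_le/(_ e e0)[r /= r0 hr] := @psi_left s.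
  near=> n.
  have [k [-> ks sk]] := stepE n sI.
  apply: hr => //=; rewrite gtr0_norm ?subr_gt0//.
  apply: le_lt_trans (_ : n.+1%:R^-1 < r); first by rewrite lerBlDl.
  by near: n; exact: near_infty_natSinv_lt (PosNum r0).
- apply/integrableP; split; first exact: measurable_cst.
  rewrite (integral_cst _ mI) [X in (_ * X)%E]stieltjes_measure_itvoc ?lerDl//.
  by rewrite -EFinM ltry.
- apply: aeW => s n sI; rewrite /cst/= lee_fin.
  have [k [-> ks sk]] := stepE n sI.
  rewrite ger0_norm//; apply: psi_ni.
  by rewrite /p lerDl mulr_ge0// invr_ge0.
Unshelve. all: by end_near. Qed.

End stieltjes_riemann_sum.

Section stieltjes_measurability.
Context {R : realType} {d : measure_display} {T : measurableType d}.
Variables (g psi : R -> T -> R).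
Hypotheses (mg : forall t, measurable_fun setT (g t))
  (mpsi : forall t, measurable_fun setT (psi t))
  (g_nd : forall w, {homo g^~ w : s t / s <= t})
  (g_rc : forall w, right_continuous (g^~ w))
  (psi0 : forall s w, 0 <= psi s w)
  (psi_ni : forall w, {homo psi^~ w : s t / s <= t >-> t <= s})
  (psi_left : forall t w, psi s w @[s --> t^'-] --> psi t w).

(** For a fixed grid on a bounded interval the left Riemann sum is a finite
combination of measurable functions of [w]; refining the grid and then
exhausting the line by bounded intervals are two pointwise limits. *)
Lemma measurable_stieltjes_integral : measurable_fun setT
  (fun w => stieltjes_integral (g^~ w) setT (psi^~ w)).
Proof.
pose I (m : nat) : set R := `]- m%:R, - m%:R + (m + m)%:R]%classic.
have IE m s : I m s = (- m%:R < s <= m%:R) :> Prop.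
  by rewrite /I/= in_itv/= natrD addKr.
apply: (@emeasurable_fun_cvg _ _ _ _
  (fun m w => stieltjes_integral (g^~ w) (I m) (psi^~ w))) => [m|w _].
- apply: (@emeasurable_fun_cvg _ _ _ _ (fun n w => (left_riemann_sum
    (cumulative_of (conj (@g_nd w) (@g_rc w))) (psi^~ w) (- m%:R) (m + m) n)%:E)).
    move=> n; apply/measurable_EFinP; apply: measurable_sum => k.
    by apply: measurable_funM => //; exact: (measurable_funB (mg _) (mg _)).
  move=> w _; rewrite (stieltjes_integralE _ _ (conj (@g_nd w) (@g_rc w))).
  by apply: left_riemann_sum_cvg.
- rewrite (stieltjes_integralE _ _ (conj (@g_nd w) (@g_rc w))).
  under eq_fun do rewrite (stieltjes_integralE _ _ (conj (@g_nd w) (@g_rc w))).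
  have -> : [set: R] = \bigcup_m I m.
    apply/seteqP; split => // s _; exists (Num.truncn `|s|).+1 => //.
    by rewrite IE; have := truncnS_gt `|s|; rewrite ltr_norml => /andP[-> /ltW ->].
  apply: ge0_nondecreasing_set_cvg_integral.
  - move=> m n mn; apply/subsetPset => s; rewrite !IE => /andP[ms sm].
    apply/andP; split.
      by apply: le_lt_trans ms; rewrite lerN2 ler_nat.
    by apply: le_trans sm _; rewrite ler_nat.
  - by move=> m; exact: measurable_itv.
  - move=> m; apply/measurable_EFinP; apply: nonincreasing_measurable.
      exact: measurable_itv.
    exact: psi_ni.
  - by move=> m s _; rewrite lee_fin.
Qed.

End stieltjes_measurability.

(** * Expectation of a shifted function *)

Section integral_shift.
Context {R : realType} {d : measure_display} {T : measurableType d}.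
Variable P : probability T R.
Local Open Scope ereal_scope.

(** Adding [k] changes the integrals of the positive and of the negative part by
at most [`|k|], so each of them is infinite for the shifted function exactly
when it is for [G]; here an infinite negative part forces the value [-oo]. When
all of them are finite, the value follows by integrating the pointwise
identity between the four parts. *)
Lemma integral_cstD (G : T -> \bar R) (k : R) : measurable_fun setT G ->
  \int[P]_w (G w + k%:E) = \int[P]_w G w + k%:E.
Proof.
move=> mG; pose H := fun w => G w + k%:E.
have mH : measurable_fun setT H by exact: emeasurable_funD.
have cstE c : c%:E = \int[P]_w (cst c%:E) w.
  by rewrite integral_cst// [X in _ * X](probability_setT P) mule1.
pose c : R := `|k|%R; have c0 : (0 <= c)%R by exact: normr_ge0.
have kc : (k <= c)%R by exact: ler_norm.
have Nkc : (- c <= k)%R by rewrite /c lerNl -normrN ler_norm.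
have shift (f1 f2 : T -> \bar R) : measurable_fun setT f1 ->
    measurable_fun setT f2 -> (forall w, 0 <= f1 w) -> (forall w, 0 <= f2 w) ->
    (forall w, f1 w <= f2 w + c%:E) ->
    \int[P]_w f1 w <= \int[P]_w f2 w + c%:E.
  move=> mf1 mf2 f10 f20 f12; rewrite (cstE c) -ge0_integralD//.
  by apply: ge0_le_integral => //; exact: emeasurable_funD.
have mGp := measurable_funepos mG; have mGn := measurable_funeneg mG.
have mHp := measurable_funepos mH; have mHn := measurable_funeneg mH.
have maxD (x y : R) : (y <= c)%R -> maxe (x + y)%:E 0 <= maxe x%:E 0 + c%:E.
  move=> yc; rewrite -!EFin_max -EFinD lee_fin ge_max; apply/andP; split.
    by rewrite lerD// le_max lexx.
  by rewrite addr_ge0// le_max lexx orbT.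
have posneg (x : R) : (Order.max x 0 - Order.max (- x) 0 = x)%R.
  by case: (leP x 0%R); case: (leP (- x)%R 0%R); lra.
have HpG : \int[P]_w H^\+ w <= \int[P]_w G^\+ w + c%:E.
  apply: shift => // w; rewrite !funeposE /H; case: (G w) => [x| |] /=.
  - exact: maxD.
  - by rewrite maxye leey.
  - by rewrite maxNye add0e lee_fin.
have GpH : \int[P]_w G^\+ w <= \int[P]_w H^\+ w + c%:E.
  apply: shift => // w; rewrite !funeposE /H; case: (G w) => [x| |] /=.
  - by have := @maxD (x + k)%R (- k)%R; rewrite addrK; apply; rewrite lerNl.
  - by rewrite maxye leey.
  - by rewrite maxNye add0e lee_fin.
have HnG : \int[P]_w H^\- w <= \int[P]_w G^\- w + c%:E.
  apply: shift => // w; rewrite !funenegE /H; case: (G w) => [x| |] /=.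
  - by have := @maxD (- x)%R (- k)%R; rewrite -opprD; apply; rewrite lerNl.
  - by rewrite maxNye add0e lee_fin.
  - by rewrite maxye leey.
have GnH : \int[P]_w G^\- w <= \int[P]_w H^\- w + c%:E.
  apply: shift => // w; rewrite !funenegE /H; case: (G w) => [x| |] /=.
  - by have := @maxD (- (x + k))%R k; rewrite opprD addrNK; apply.
  - by rewrite maxNye add0e lee_fin.
  - by rewrite maxye leey.
(* The constant [c] on both sides keeps all integrands nonnegative. *)
have balance : \int[P]_w H^\+ w + \int[P]_w G^\- w + c%:E =
    \int[P]_w H^\- w + \int[P]_w G^\+ w + (c + k)%:E.
  rewrite (cstE c) (cstE (c + k)%R) -!ge0_integralD//; last 5 first.
  - by move=> w _; rewrite adde_ge0.
  - exact: emeasurable_funD.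
  - by move=> w _; rewrite lee_fin; lra.
  - by move=> w _; rewrite adde_ge0.
  - exact: emeasurable_funD.
  apply: eq_integral => w _; rewrite !funeposE !funenegE /H.
  case: (G w) => [x| |] //=.
    rewrite -!EFin_max -!EFinD; congr (_%:E).
    by have := posneg x; have := posneg (x + k)%R; lra.
  - by rewrite !maxye !maxNye.
  - by rewrite !maxye !maxNye.
have Gn0 : 0 <= \int[P]_w G^\- w by exact: integral_ge0.
have Hn0 : 0 <= \int[P]_w H^\- w by exact: integral_ge0.
have Gp0 : 0 <= \int[P]_w G^\+ w by exact: integral_ge0.
have Hp0 : 0 <= \int[P]_w H^\+ w by exact: integral_ge0.
rewrite -/H (integralE P setT H) (integralE P setT G).
move: (\int[P]_w H^\+ w) (\int[P]_w H^\- w) (\int[P]_w G^\+ w) (\int[P]_w G^\- w)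
  Gn0 Hn0 Gp0 Hp0 HpG GpH HnG GnH balance => Hp Hn Gp Gn.
case: Gn => [gn| |] // _; last by case: Hn => [hn| |] //= *; rewrite !addeNy.
case: Hn => [hn| |] //= _; case: Gp => [gp| |] //= _; case: Hp => [hp| |] //= _.
by move=> _ _ _ _; rewrite -!EFinD => -[?]; congr (_%:E); lra.
Qed.

End integral_shift.

(** * The controlled surplus and its payoff *)

Lemma discount_continuous {R : realType} (rho : R) :
  continuous (fun s => expR (- (rho * s))).
Proof.
move=> t; apply: (@continuous_comp _ _ _ (fun s => - (rho * s)) expR).
  by apply: cvgN; apply: cvgMl_tmp; exact: cvg_id.
exact: continuous_expR.
Qed.

Lemma measurable_rightlim {R : realType} {d} {T : measurableType d}
    (X : R -> T -> R) t : (forall s, measurable_fun setT (X s)) ->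
  (forall w, cvg (X s w @[s --> t^'+])) ->
  measurable_fun setT (fun w => rightlim (X^~ w) t).
Proof.
move=> mX cX.
apply: (@measurable_fun_cvg _ _ _ _ (fun n w => X (t + n.+1%:R^-1) w)) => // w _.
exact: cvg_rightlim_sequence.
Qed.

Section controlled_reserve.
Context {R : realType} {d : measure_display} {Omega : measurableType d}
  {P : probability Omega R} {Ft : R -> set (set Omega)}
  {c rho delta : R} {N : R -> Omega -> nat} {Y : nat -> {RV P >-> R}}.
Hypotheses (hFt : complete_right_continuous_filtration P Ft)
  (c0 : 0 < c) (rho0 : 0 < rho) (delta0 : 0 < delta)
  (N_counting : counting_process N) (Y_gt0 : forall k w, 0 < Y k w)
  (S_adapted : adapted Ft (uncontrolled_surplus c N Y 0)).
Hypothesis Ft0_trivial : forall A, Ft 0 A -> (P A = 0 \/ P A = 1)%E.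

Local Notation S := (uncontrolled_surplus c N Y).
Local Notation X := (controlled_surplus c N Y).
Local Notation strategy := (strategy R Omega).
Local Notation admissible := (admissible Ft c N Y).
Implicit Types (x k t s : R) (w : Omega) (alpha : strategy).

Lemma adapted_measurable (Z : R -> Omega -> R) : adapted Ft Z ->
  forall t, 0 <= t -> measurable_fun setT (Z t).
Proof.
move=> aZ t t0 _ B mB; rewrite setTI.
exact: (filtration_measurable hFt t0 (aZ _ t0 _ mB)).
Qed.

Lemma surplus_le0 x t w : t <= 0 -> S x t w = x.
Proof.
move=> t0; rewrite /uncontrolled_surplus (counting_le0 N_counting)// big_ord0.
by rewrite max_l// mulr0 addr0 subr0.
Qed.

Lemma surplusE x t w : S x t w = x + S 0 t w.
Proof. by rewrite /uncontrolled_surplus add0r addrA. Qed.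

Lemma surplus_measurable t : measurable_fun setT (S 0 t).
Proof.
have [t0|t0] := leP 0 t; first exact: adapted_measurable.
have -> : S 0 t = cst 0 by apply/funext => w; rewrite surplus_le0// ltW.
exact: measurable_cst.
Qed.

Lemma claims_homo w : {homo (fun t => \sum_(k < N t w) Y k w) : s t / s <= t}.
Proof.
move=> s t st; have := counting_nondecreasing N_counting w st.
move: (N s w) (N t w) => m n mn; rewrite -(subnKC mn) big_split_ord/=.
by rewrite lerDl sumr_ge0// => i _; exact: ltW.
Qed.

Lemma premium_homo x : {homo (fun t => x + c * Num.max 0 t) : s t / s <= t}.
Proof.
move=> s t st; rewrite lerD2l ler_pM2l// ge_max le_max lexx/=.
by rewrite le_max st orbT.
Qed.

Lemma controlled_cvg_left x alpha t w :
  {homo alpha.1^~ w : u v / u <= v} -> {homo alpha.2^~ w : u v / u <= v} ->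
  cvg (X x alpha s w @[s --> t^'-]).
Proof.
move=> ndZ ndK; rewrite /controlled_surplus /uncontrolled_surplus.
apply: is_cvgD; last exact: nondecreasing_cvg_at_left ndK.
apply: is_cvgB; last exact: nondecreasing_cvg_at_left ndZ.
apply: is_cvgB; first exact: nondecreasing_cvg_at_left (premium_homo x).
exact: nondecreasing_cvg_at_left (@claims_homo w).
Qed.

Lemma controlled_cvg_right x alpha t w :
  {homo alpha.1^~ w : u v / u <= v} -> {homo alpha.2^~ w : u v / u <= v} ->
  cvg (X x alpha s w @[s --> t^'+]).
Proof.
move=> ndZ ndK; rewrite /controlled_surplus /uncontrolled_surplus.
apply: is_cvgD; last exact: nondecreasing_cvg_at_right ndK.
apply: is_cvgB; last exact: nondecreasing_cvg_at_right ndZ.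
apply: is_cvgB; first exact: nondecreasing_cvg_at_right (premium_homo x).
exact: nondecreasing_cvg_at_right (@claims_homo w).
Qed.

Section admissible_strategy.
Variables (x : R) (alpha : strategy).
Hypothesis adm : admissible x alpha.

Let ndZ w := dividend_nondecreasing adm w.
Let ndK w := injection_nondecreasing adm w.

Lemma injection_le0 t w : t <= 0 -> alpha.2 t w = 0.
Proof.
rewrite le_eqVlt => /predU1P[->|]; last exact: (injection_lt0 adm).
have <- : leftlim (alpha.2^~ w) 0 = alpha.2 0 w.
  by apply: cvg_lim => //; exact: (injection_left_continuous adm).
apply: leftlim_near_cst; near=> s; apply: (injection_lt0 adm).
by near: s; exact: nbhs_left_lt.
Unshelve. all: by end_near. Qed.

(** At time 0 no claim has occurred and the reserve is [x <= 0], so the bound on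
the dividend jumps forbids any payment. *)
Lemma dividend_le0 t w : x <= 0 -> t <= 0 -> alpha.1 t w = 0.
Proof.
move=> x0; rewrite le_eqVlt => /predU1P[->|]; last exact: (dividend_lt0 adm).
apply/eqP; rewrite eq_le; apply/andP; split; last first.
  by have := @ndZ w _ _ (lerN10 R); rewrite (dividend_lt0 adm _ (ltrN10 R)).
have := dividend_jump adm w (lexx 0).
rewrite (leftlim_near_cst (x := 0)); last first.
  near=> s; apply: (dividend_lt0 adm); near: s; exact: nbhs_left_lt.
rewrite (leftlim_near_cst (x := x)); last first.
  near=> s; have s0 : s < 0 by near: s; exact: nbhs_left_lt.
  rewrite /controlled_surplus surplus_le0 ?(ltW s0)//.
  by rewrite (dividend_lt0 adm)// (injection_lt0 adm)// subr0 addr0.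
rewrite (leftlim_near_cst (x := 0)); last first.
  near=> s; apply: surplus_le0; near: s; exact: nbhs_left_le.
by rewrite surplus_le0// addr0 !subr0 max_l.
Unshelve. all: by end_near. Qed.

Lemma dividend_measurable t : measurable_fun setT (alpha.1 t).
Proof.
have [t0|t0] := leP 0 t.
  exact: (adapted_measurable (dividend_adapted adm)).
have -> : alpha.1 t = cst 0 by apply/funext => w; exact: (dividend_lt0 adm).
exact: measurable_cst.
Qed.

Lemma injection_measurable t : measurable_fun setT (alpha.2 t).
Proof.
have [t0|t0] := leP 0 t.
  exact: (adapted_measurable (injection_adapted adm)).
have -> : alpha.2 t = cst 0 by apply/funext => w; exact: (injection_lt0 adm).
exact: measurable_cst.
Qed.

Lemma controlled_measurable t : measurable_fun setT (X x alpha t).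
Proof.
apply: measurable_funD; last exact: injection_measurable.
apply: measurable_funB; last exact: dividend_measurable.
have -> : S x t = (fun w => x + S 0 t w) by apply/funext => w; exact: surplusE.
exact: measurable_funD (measurable_cst _) (surplus_measurable t).
Qed.

Local Notation tau := (ruin_time c N Y x alpha).

Lemma ruin_time_ge0 w : (0 <= tau w)%E.
Proof. by apply: le_ereal_inf_tmp => _ [t [t0 _] <-]; rewrite lee_fin. Qed.

(** A negative right limit at [t] keeps the surplus, hence its right limits,
below half of that value on some interval following [t], which contains a
rational. *)
Lemma ruin_time_ltP u w : (tau w < u%:E)%E <->
  exists q : rat, [/\ 0 <= ratr q :> R, (ratr q : R) < u &
    rightlim (X x alpha ^~ w) (ratr q) < 0].
Proof.
split=> [/ereal_inf_lt[_ [t [t0 Xt] <-]]|[q [q0 qu Xq]]]; last first.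
  by apply/ereal_inf_ltP; exists (ratr q)%:E => //; exists (ratr q).
rewrite lte_fin => tu.
pose l := rightlim (X x alpha ^~ w) t.
have : X x alpha s w @[s --> t^'+] --> l by exact: controlled_cvg_right (@ndZ _) (@ndK _).
have l2 : l < l / 2 by rewrite /l; move: Xt; lra.
move=> /cvgr_lt/(_ _ l2)[r /= r0 Xr].
have [|q] := @rat_in_itvoo _ t (Order.min u (t + r)).
  by rewrite lt_min tu ltrDl.
rewrite in_itv/= lt_min => /and3P[tq qu qr].
exists q; split => //; first by rewrite (le_trans t0)// ltW.
apply: (@le_lt_trans _ _ (l / 2)); last by rewrite /l; move: Xt; lra.
apply: limr_le; first exact: controlled_cvg_right (@ndZ _) (@ndK _).
near=> s; apply/ltW/Xr => /=.
  rewrite ltr0_norm; last by rewrite subr_lt0 (lt_trans tq)//.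
  rewrite opprB ltrBlDl; near: s; exact: nbhs_right_lt.
by rewrite (lt_trans tq)//.
Unshelve. all: by end_near. Qed.

Lemma ruin_time_measurable u : measurable [set w | (u%:E <= tau w)%E].
Proof.
have -> : [set w | (u%:E <= tau w)%E] = ~` [set w | (tau w < u%:E)%E].
  by apply/seteqP; split=> w /=; rewrite leNgt => /negP.
apply: measurableC.
have -> : [set w | (tau w < u%:E)%E] = \bigcup_(q : rat)
    [set w | [/\ 0 <= ratr q :> R, (ratr q : R) < u &
      rightlim (X x alpha ^~ w) (ratr q) < 0]].
  apply/seteqP; split=> w /=; first by move=> /ruin_time_ltP[q ?]; exists q.
  by move=> [q _ ?]; apply/ruin_time_ltP; exists q.
apply: bigcupT_measurable_rat => q.
have [q0|q0] := leP 0 (ratr q : R); last first.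
  by rewrite (_ : [set _ | _] = set0)//; apply/seteqP; split=> w //= [].
have [qu|qu] := ltP (ratr q : R) u; last first.
  by rewrite (_ : [set _ | _] = set0)//; apply/seteqP; split=> w //= [].
rewrite (_ : [set _ | _] =
  (fun w => rightlim (X x alpha ^~ w) (ratr q)) @^-1` `]-oo, 0[%classic); last first.
  by apply/seteqP; split=> w /=; rewrite in_itv/=; [case|].
rewrite -[_ @^-1` _]setTI; apply: measurable_rightlim => //.
- exact: controlled_measurable.
- by move=> w; exact: controlled_cvg_right (@ndZ _) (@ndK _).
Qed.

Definition payoff w : \bar R :=
  (stieltjes_integral (alpha.1^~ w) (until_ruin c N Y x alpha w)
     (fun s => expR (- (rho * s)))
   - delta%:E
     * stieltjes_integral (rightlim (alpha.2^~ w)) (until_ruin c N Y x alpha w)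
         (fun s => expR (- (rho * s))))%E.

(** Ruin is a random time, so the domain of integration is moved into the
integrand: the discount factor times the indicator of [s <= tau] is
nonincreasing and left-continuous in [s]. Negative times carry no mass of
[g]. *)
Lemma discounted_until_ruin_measurable (g : R -> Omega -> R) :
  (forall t, measurable_fun setT (g t)) -> (forall t w, t < 0 -> g t w = 0) ->
  (forall w, {homo g^~ w : s t / s <= t}) -> (forall w, right_continuous (g^~ w)) ->
  measurable_fun setT (fun w => stieltjes_integral (g^~ w)
    (until_ruin c N Y x alpha w) (fun s => expR (- (rho * s)))).
Proof.
move=> mg g0 ndg rcg.
pose psi s w : R := expR (- (rho * s)) * \1_[set w | (s%:E <= tau w)%E] w.
have psiT s w : (s%:E <= tau w)%E -> psi s w = expR (- (rho * s)).
  by move=> sT; rewrite /psi indicE mem_set// mulr1.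
have psiF s w : (tau w < s%:E)%E -> psi s w = 0.
  by move=> sT; rewrite /psi indicE memNset ?mulr0//=; apply/negP; rewrite -ltNge.
have psi_ge0 s w : 0 <= psi s w by rewrite /psi mulr_ge0// expR_ge0.
have psi_ni w : {homo psi^~ w : s t / s <= t >-> t <= s}.
  move=> s t st; have [tT|tT] := leP t%:E (tau w); last by rewrite psiF.
  rewrite !psiT//; last by rewrite (le_trans _ tT)// lee_fin.
  by rewrite ler_expR lerN2 ler_pM2l.
have psi_left t w : psi s w @[s --> t^'-] --> psi t w.
  have [tT|tT] := leP t%:E (tau w).
    rewrite psiT//.
    apply: cvg_trans (cvg_at_left_filter (@discount_continuous _ rho t)).
    apply: near_eq_cvg; near=> s; rewrite psiT// (le_trans _ tT)// lee_fin.
    by near: s; exact: nbhs_left_le.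
  rewrite psiF//; apply: cvg_near_cst.
  (* [0 <= tau < t] makes [tau] finite. *)
  have [r Tr rt] : exists2 r, (tau w <= r%:E)%E & r < t.
    move: tT (ruin_time_ge0 w); case: (tau w) => [r| |] //=.
    by rewrite lte_fin => rt _; exists r.
  near=> s; apply: psiF; apply: (le_lt_trans Tr); rewrite lte_fin.
  by near: s; exact: nbhs_left_gt.
have mpsi s : measurable_fun setT (psi s).
  apply: measurable_funM; first exact: measurable_cst.
  by apply: measurable_indic; exact: ruin_time_measurable.
rewrite (_ : (fun w => _) = fun w => stieltjes_integral (g^~ w) setT (psi^~ w)).
  exact: measurable_stieltjes_integral.
apply/funext => w; pose H := conj (ndg w) (rcg w).
rewrite !(stieltjes_integralE _ _ H).
have mpsiw : measurable_fun (setT : set (measurableTypeR R)) (fun s => (psi s w)%:E).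
  by apply/measurable_EFinP; apply: nonincreasing_measurable => // s t; exact: psi_ni.
rewrite [RHS](@ge0_negligible_integral _ (measurableTypeR R) _ _ setT
  `]-oo, 0[%classic (fun s => (psi s w)%:E))//; last 2 first.
- by move=> s _; rewrite lee_fin.
- by apply: stieltjes_measure_lt0 => t; exact: g0.
rewrite [LHS](@integral_mkcond _ (measurableTypeR R)) [RHS]integral_mkcond.
apply: eq_integral => s _.
rewrite !patchE; case: ifPn => [|].
  rewrite inE => -[s0 sT]; rewrite mem_set ?psiT//.
  by split => //=; rewrite in_itv/= ltNge s0.
rewrite notin_setE => sT; case: ifPn => // /set_mem[_ /=].
rewrite in_itv/= => /negP; rewrite -leNgt => s0.
rewrite psiF// ltNge; apply/negP => sT'; exact: sT.
Unshelve. all: by end_near. Qed.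

Lemma payoff_measurable : measurable_fun setT payoff.
Proof.
apply: emeasurable_funB.
  apply: discounted_until_ruin_measurable => //.
  - exact: dividend_measurable.
  - by move=> t w; exact: (dividend_lt0 adm).
  - exact: (dividend_right_continuous adm).
apply: measurable_funeM; apply: (discounted_until_ruin_measurable
    (g := fun t w => rightlim (alpha.2^~ w) t)) => //.
- move=> t; apply: measurable_rightlim; first exact: injection_measurable.
  by move=> w; exact: nondecreasing_cvg_at_right (@ndK w).
- move=> t w t0; apply: rightlim_near_cst; near=> s.
  apply: (injection_lt0 adm); near: s; exact: nbhs_right_lt.
- by move=> w; exact: rightlim_homo (@ndK w).
- by move=> w; exact: rightlim_right_continuous (@ndK w).
Unshelve. all: by end_near. Qed.

End admissible_strategy.

(** * Shifting the initial injection *)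

(** Left-continuity makes the injections vanish up to and including time 0, so the
initial lump sum is [K(0+)] and the added amount [k] enters at positive times
only. When [k] is negative, the truncation at 0 keeps the injections monotone
on the paths where the initial lump sum is smaller than [-k]; it has no effect
on the other paths. *)
Definition shift_injection k alpha : strategy :=
  (alpha.1, fun t w => if t <= 0 then alpha.2 t w else Num.max 0 (alpha.2 t w + k)).

Section shift.
Variables (x k : R) (alpha : strategy).
Hypotheses (x0 : x <= 0) (adm : admissible x alpha).

Let ndZ w := dividend_nondecreasing adm w.
Let ndK w := injection_nondecreasing adm w.

Lemma shift_injection_homo w : {homo (shift_injection k alpha).2^~ w : s t / s <= t}.
Proof.
move=> s t st /=; have [s0|s0] := leP s 0.
  rewrite (injection_le0 adm)//; have [t0|t0] := leP t 0.
    by rewrite (injection_le0 adm).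
  by rewrite le_max lexx.
have -> : (t <= 0) = false by rewrite leNgt (lt_le_trans s0).
rewrite ge_max le_max lexx/= le_max lerD2r.
by rewrite (@ndK w _ _ st) orbT.
Qed.

(** The truncation can only raise the surplus; this keeps the dividend constraint
satisfied on every path, also where the initial injection is too small. *)
Lemma shift_controlled_ge t w : 0 < t ->
  X x alpha t w <= X (x - k) (shift_injection k alpha) t w.
Proof.
move=> t0; rewrite /controlled_surplus/= [t <= 0]leNgt t0/=.
rewrite surplusE [leRHS](_ : _ = S 0 t w - alpha.1 t w + x +
  (Num.max 0 (alpha.2 t w + k) - k)); last by rewrite [S (x - k) t w]surplusE; ring.
rewrite (_ : _ + _ = S 0 t w - alpha.1 t w + x + alpha.2 t w); last by ring.
by rewrite lerD2l lerBrDr le_max lexx orbT.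
Qed.

Lemma shift_controlled t w : 0 < t -> 0 <= alpha.2 t w + k ->
  X (x - k) (shift_injection k alpha) t w = X x alpha t w.
Proof.
move=> t0 Kk; rewrite /controlled_surplus/= [t <= 0]leNgt t0/= max_r//.
by rewrite surplusE [in RHS]surplusE; ring.
Qed.

Lemma shift_admissible : admissible (x - k) (shift_injection k alpha).
Proof.
split=> /=.
- exact: (dividend_adapted adm).
- exact: (dividend_lt0 adm).
- exact: (dividend_nondecreasing adm).
- exact: (dividend_right_continuous adm).
- exact: (dividend_left_limits adm).
- move=> t w; rewrite le_eqVlt => /predU1P[<-|t0].
    rewrite (dividend_le0 adm)// (leftlim_near_cst (x := 0)).
      by rewrite subr0 le_max lexx.
    near=> s; apply: (dividend_lt0 adm); near: s; exact: nbhs_left_lt.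
  apply: le_trans (dividend_jump adm w (ltW t0)) _.
  rewrite ge_max le_max lexx/= le_max; apply/orP; right.
  rewrite lerD2r lerD2r; apply: ler_lim.
  + by apply: controlled_cvg_left; [exact: ndZ|exact: ndK].
  + by apply: controlled_cvg_left; [exact: ndZ|exact: shift_injection_homo].
  + near=> s; apply: shift_controlled_ge; near: s; exact: nbhs_left_gt.
- move=> t; rewrite le_eqVlt => /predU1P[<-|t0] B mB.
    by rewrite lexx; exact: (injection_adapted adm).
  rewrite leNgt t0/=.
  rewrite (_ : _ @^-1` B = alpha.2 t @^-1` ((fun z => Num.max 0 (z + k)) @^-1` B))//.
  apply: (injection_adapted adm (ltW t0)).
  rewrite -[_ @^-1` _]setTI.
  suff : measurable_fun setT (fun z : R => Num.max 0 (z + k)) by exact.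
  by apply: measurable_maxr => //; exact: measurable_funD.
- by move=> t w t0; rewrite ltW// (injection_lt0 adm).
- exact: shift_injection_homo.
- move=> t w; have [t0|t0] := leP t 0.
    apply: cvg_trans (injection_left_continuous adm (t := t) (w := w)).
    apply: near_eq_cvg; near=> s.
    have -> // : s <= 0 by rewrite (le_trans _ t0)//; near: s; exact: nbhs_left_le.
  have : Num.max 0 (alpha.2 s w + k) @[s --> t^'-] --> Num.max 0 (alpha.2 t w + k).
    have cm : {for alpha.2 t w, continuous (cst 0 \max (fun z : R => z + k))}.
      apply: continuous_max; first exact: cvg_cst.
      by apply: cvgD; [exact: cvg_id|exact: cvg_cst].
    exact: (cvg_comp _ _ (injection_left_continuous adm (t := t) (w := w)) cm).
  apply: cvg_trans; apply: near_eq_cvg; near=> s; rewrite leNgt.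
  by have -> // : 0 < s by near: s; exact: nbhs_left_gt.
- by move=> t w; exact: nondecreasing_cvg_at_right (@shift_injection_homo w).
Unshelve. all: by end_near. Qed.

Lemma shift_until_ruin w : 0 <= rightlim (alpha.2^~ w) 0 + k ->
  until_ruin c N Y (x - k) (shift_injection k alpha) w = until_ruin c N Y x alpha w.
Proof.
move=> K0; have Xlim t : 0 <= t ->
    rightlim (X (x - k) (shift_injection k alpha) ^~ w) t = rightlim (X x alpha ^~ w) t.
  move=> t0; apply: near_eq_rightlim; near=> s.
  have s0 : 0 < s by apply: le_lt_trans t0 _; near: s; exact: nbhs_right_gt.
  by apply: shift_controlled => //; apply: le_trans K0 _; rewrite lerD2r rightlim_le.
rewrite /until_ruin /ruin_time (_ : [set t : R | 0 <= t /\
    rightlim (X (x - k) (shift_injection k alpha) ^~ w) t < 0] =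
  [set t : R | 0 <= t /\ rightlim (X x alpha ^~ w) t < 0])//.
by apply/seteqP; split=> t [t0] /=; rewrite Xlim.
Unshelve. all: by end_near. Qed.

Lemma until_ruin_measurable w : measurable (until_ruin c N Y x alpha w).
Proof.
apply: is_interval_measurable => s t [s0 sT] [t0 tT] u /andP[su ut].
split; first exact: le_trans su.
by apply: le_trans tT; rewrite lee_fin.
Qed.

Lemma shift_injection_rightlim_lt0 t w : t < 0 ->
  rightlim ((shift_injection k alpha).2^~ w) t = rightlim (alpha.2^~ w) t.
Proof.
move=> t0; apply: near_eq_rightlim; near=> s.
by rewrite /= ifT//; near: s; exact: nbhs_right_le.
Unshelve. all: by end_near. Qed.

Lemma shift_injection_rightlim t w : 0 <= t -> 0 <= rightlim (alpha.2^~ w) 0 + k ->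
  rightlim ((shift_injection k alpha).2^~ w) t = rightlim (alpha.2^~ w) t + k.
Proof.
move=> t0 K0.
rewrite (@near_eq_rightlim _ _ (fun s => alpha.2 s w + k)); last first.
  near=> s; have s0 : 0 < s by apply: le_lt_trans t0 _; near: s; exact: nbhs_right_gt.
  rewrite /= leNgt s0/= max_r//; apply: le_trans K0 _.
  by rewrite lerD2r rightlim_le.
apply: cvg_lim => //; apply: cvgD; last exact: cvg_cst.
exact: nondecreasing_cvg_at_right (@ndK w).
Unshelve. all: by end_near. Qed.

(** Starting from [x - k] and injecting [k] more at time 0 leaves the surplus at
positive times, the dividends and the ruin time unchanged; the cost of the
injections gains the mass [k] at time 0, where the discount factor is 1. *)
Lemma payoff_shift w : 0 <= rightlim (alpha.2^~ w) 0 + k ->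
  payoff (x - k) (shift_injection k alpha) w = (payoff x alpha w + (- (delta * k))%:E)%E.
Proof.
move=> K0; rewrite /payoff shift_until_ruin//=.
set D := until_ruin _ _ _ _ _ _; set h := fun s => expR _.
set A := stieltjes_integral (alpha.1^~ w) D h.
set B := stieltjes_integral _ D h; set B' := stieltjes_integral _ D h.
have h0 s : 0 <= h s by exact: expR_ge0.
have mh : measurable_fun setT h.
  by apply: continuous_measurable_fun; exact: discount_continuous.
have h01 : h 0 = 1 by rewrite /h mulr0 oppr0 expR0.
have mD : measurable D by exact: until_ruin_measurable.
have D0 : D 0 by split => //; exact: ruin_time_ge0.
have B0 : (0 <= B)%E by exact: stieltjes_integral_ge0.
have B'0 : (0 <= B')%E by exact: stieltjes_integral_ge0.
have BB' : B = (B' + k%:E)%E.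
  have [k0|k0] := leP 0 k.
    rewrite -[k in RHS]mulr1 -h01.
    apply: stieltjes_integral_jump => //.
    - exact: rightlim_homo (@ndK w).
    - exact: rightlim_right_continuous (@ndK w).
    - by move=> t; exact: shift_injection_rightlim_lt0.
    - by move=> t; move/shift_injection_rightlim; exact.
  (* A negative [k] is a nonnegative jump in the opposite direction. *)
  have -> : B' = (B + (- k)%:E)%E.
    rewrite -[(- k)%R]mulr1 -h01.
    apply: stieltjes_integral_jump => //.
    - by rewrite oppr_ge0 ltW.
    - exact: rightlim_homo (@shift_injection_homo w).
    - exact: rightlim_right_continuous (@shift_injection_homo w).
    - by move=> t t0; rewrite shift_injection_rightlim_lt0.
    - by move=> t t0; rewrite shift_injection_rightlim// addrK.
  by case: B {B0} => [?| |] //=; rewrite -!EFinD addrNK.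
rewrite BB'; case: B' B'0 {BB'} => [b'| |] //= _.
  case: A => [a| |] //=.
  by congr (_%:E); ring.
by rewrite gt0_muley ?lte_fin//; case: A.
Qed.

Lemma reward_shift :
  {ae P, forall w, 0 <= rightlim (alpha.2^~ w) 0 + k} ->
  reward c rho delta N Y (x - k) (shift_injection k alpha) =
  (reward c rho delta N Y x alpha + (- (delta * k))%:E)%E.
Proof.
move=> K0; rewrite /reward -[X in (X + _)%E]/(\int[P]_w payoff x alpha w)%E.
rewrite -integral_cstD; last exact: payoff_measurable.
apply: ae_eq_integral => //.
- exact/payoff_measurable/shift_admissible.
- apply: emeasurable_funD; [exact: payoff_measurable|exact: measurable_cst].
- by apply: filterS K0 => w K0 _; exact: payoff_shift.
Qed.

End shift.

(** * Immediate ruin and the value at a negative reserve *)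

Section immediate_ruin.
Variables (x : R) (alpha : strategy).
Hypotheses (x0 : x <= 0) (adm : admissible x alpha).

Let ndZ w := dividend_nondecreasing adm w.
Let ndK w := injection_nondecreasing adm w.

(** [K(0+) < -x] means that [K(s / n) < -x] for some [n], which is an event of the
filtration at time [s]; as [s] is arbitrary, right-continuity brings the event
back to time 0. *)
Lemma initial_injection_event :
  Ft 0 [set w | rightlim (alpha.2^~ w) 0 + x < 0].
Proof.
apply: (filtration_right_continuous hFt) => // s s0.
have -> : [set w | rightlim (alpha.2^~ w) 0 + x < 0] =
    \bigcup_n (alpha.2 (s / n.+1%:R) @^-1` `]-oo, (- x)[%classic).
  apply/seteqP; split=> w /=.
    rewrite -ltrBrDr sub0r => Kx.
    have : alpha.2 t w @[t --> 0^'+] --> rightlim (alpha.2^~ w) 0.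
      by apply: nondecreasing_cvg_at_right; exact: ndK.
    move=> /cvgr_lt/(_ _ Kx)[r /= r0 Kr].
    have [n rn] : exists n : nat, n.+1%:R^-1 < r / s.
      near \oo => n; exists n; near: n.
      exact: near_infty_natSinv_lt (PosNum (divr_gt0 r0 s0)).
    exists n => //=; rewrite in_itv/=; apply: Kr => /=.
      by rewrite sub0r normrN gtr0_norm ?divr_gt0// mulrC -ltr_pdivlMr.
    by rewrite divr_gt0.
  move=> [n _]; rewrite /= in_itv/= => Kx.
  rewrite -ltrBrDr sub0r; apply: le_lt_trans Kx.
  by apply: rightlim_le; [exact: ndK|rewrite divr_gt0].
have [_ _ FU] := filtration_sigma_algebra hFt (ltW s0).
apply: FU => n; apply: (filtration_nondecreasing hFt (s := s / n.+1%:R)).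
- by rewrite divr_ge0// ltW.
- by rewrite ler_pdivrMr// ler_peMr ?(ltW s0)// ler1n.
- apply: (injection_adapted adm); first by rewrite divr_ge0// ltW.
  exact: measurable_itv.
Unshelve. all: by end_near. Qed.

Lemma initial_injection_zero_one :
  {ae P, forall w, 0 <= rightlim (alpha.2^~ w) 0 + x} \/
  {ae P, forall w, rightlim (alpha.2^~ w) 0 + x < 0}.
Proof.
have mA := filtration_measurable hFt (lexx 0) initial_injection_event.
have [PA|PA] := Ft0_trivial initial_injection_event; [left|right].
  exists [set w | rightlim (alpha.2^~ w) 0 + x < 0]; split => // w /=.
  by move/negP; rewrite -ltNge.
exists (~` [set w | rightlim (alpha.2^~ w) 0 + x < 0]); split => //.
  exact: measurableC.
by rewrite probability_setC// PA subee.
Qed.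

(** Right after time 0 the surplus is at most [x + c * s + K(s)], which tends to
[x + K(0+)]. *)
Lemma until_ruin_immediate w : rightlim (alpha.2^~ w) 0 + x < 0 ->
  until_ruin c N Y x alpha w = [set 0].
Proof.
move=> Kx.
have T0 : ruin_time c N Y x alpha w = 0%E.
  apply/eqP; rewrite eq_le ruin_time_ge0 andbT.
  apply: ereal_inf_lbound; exists 0 => //; split => //.
  set l := rightlim (alpha.2^~ w) 0 + x.
  (* The premium and the increase of the injections after time 0 are each kept
     below [- l / 4]. *)
  apply: (@le_lt_trans _ _ (l / 2)); last by rewrite /l; move: Kx; lra.
  apply: limr_le; first by apply: controlled_cvg_right; [exact: ndZ|exact: ndK].
  have Kcvg : alpha.2 s w @[s --> 0^'+] --> rightlim (alpha.2^~ w) 0.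
    by apply: nondecreasing_cvg_at_right; exact: ndK.
  have Kl : rightlim (alpha.2^~ w) 0 < rightlim (alpha.2^~ w) 0 - l / 4.
    by rewrite /l; move: Kx; lra.
  near=> s.
  have s0 : 0 < s by near: s; exact: nbhs_right_gt.
  have Ks : alpha.2 s w < rightlim (alpha.2^~ w) 0 - l / 4.
    by near: s; apply: (cvgr_lt _ Kcvg _ Kl).
  have cs : c * s < - l / 4.
    rewrite -ltr_pdivlMl//; near: s; apply: nbhs_right_lt.
    by rewrite mulr_gt0 ?invr_gt0// /l; move: Kx; lra.
  have Zs : 0 <= alpha.1 s w.
    by rewrite -(dividend_le0 adm w x0 (lexx 0)); apply: ndZ; exact: ltW.
  have Ys : 0 <= \sum_(j < N s w) Y j w by apply: sumr_ge0 => j _; exact: ltW.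
  rewrite /controlled_surplus /uncontrolled_surplus max_r ?(ltW s0)//.
  by rewrite /l in Ks cs *; lra.
apply/seteqP; split=> [s []|_ ->]; last by split => //; rewrite T0.
by rewrite T0 lee_fin => s0 s0'; apply/eqP; rewrite eq_le s0 s0'.
Unshelve. all: by end_near. Qed.

(** Only the payments at time 0 count, and no dividend is paid then. *)
Lemma payoff_immediate w : rightlim (alpha.2^~ w) 0 + x < 0 ->
  (payoff x alpha w <= 0)%E.
Proof.
move=> Kx; rewrite /payoff until_ruin_immediate//.
have Z0 : alpha.1 (-1) w = alpha.1 0 w by rewrite !(dividend_le0 adm)// lerN10.
rewrite (stieltjes_integral_set1 _ (ltrN10 R) Z0).
rewrite sub0e oppe_le0; apply: mule_ge0; first by rewrite lee_fin ltW.
by apply: stieltjes_integral_ge0 => s; exact: expR_ge0.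
Qed.

Lemma reward_immediate : {ae P, forall w, rightlim (alpha.2^~ w) 0 + x < 0} ->
  (reward c rho delta N Y x alpha <= 0)%E.
Proof.
move=> Kx; rewrite /reward -/(\int[P]_w payoff x alpha w)%E.
have mG := payoff_measurable adm.
rewrite integralE (ge0_ae_eq_integral (g := cst 0%E) (f := (payoff x alpha)^\+)%E)//.
- by rewrite integral0 sub0e oppe_le0 integral_ge0.
- exact: measurable_funepos.
- apply: filterS Kx => w Kx _; rewrite funeposE.
  by apply/max_r/payoff_immediate.
Qed.

End immediate_ruin.

Definition null_strategy : strategy := (fun _ _ => 0, fun _ _ => 0).

Lemma null_strategy_admissible x : admissible x null_strategy.
Proof.
have adapted0 : adapted Ft (fun _ _ => 0).
  move=> t t0 B mB; rewrite preimage_cst.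
  have [F0 FC _] := filtration_sigma_algebra hFt t0.
  by case: ifP => // _; rewrite -(setD0 setT); exact: FC.
split=> //=.
- by move=> _ s t st; exact: lexx.
- by move=> _ t; exact: cvg_cst.
- by move=> t _; exact: is_cvg_cst.
- by move=> t w _; rewrite (leftlim_near_cst (x := 0)) ?subrr ?le_max ?lexx//; near=> s.
- by move=> _ s t st; exact: lexx.
- by move=> t _; exact: cvg_cst.
- by move=> t _; exact: is_cvg_cst.
Unshelve. all: by end_near. Qed.

Local Notation v := (value_function Ft c rho delta N Y).

Lemma value_ge0 x : x < 0 -> (0 <= v x)%E.
Proof.
move=> x0; have adm0 := null_strategy_admissible x.
have K0 w t : rightlim (null_strategy.2^~ w) t = 0.
  by apply: rightlim_near_cst; near=> s.
have -> : 0%E = reward c rho delta N Y x null_strategy.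
  rewrite /reward (eq_integral (cst 0%E)) ?integral0// => w _.
  rewrite until_ruin_immediate ?(ltW x0) ?K0 ?add0r//.
  rewrite !(stieltjes_integral_set1 (t := -1)) ?ltrN10 ?K0//.
  by rewrite mule0 sube0.
by apply: ereal_sup_ubound; exists null_strategy.
Unshelve. all: by end_near. Qed.

(** The reserves [x] and 0 are compared by shifting the initial injection by [x]
or by [-x]. *)
Lemma value_lt0 x : x < 0 -> v x = maxe 0%E (v 0%R + (delta * x)%:E)%E.
Proof.
move=> x0; apply/eqP; rewrite eq_le; apply/andP; split; last first.
  rewrite ge_max value_ge0//= -leeBrDr//.
  apply: ge_ereal_sup => _ [alpha adm <-]; rewrite leeBrDr//.
  have adm' := shift_admissible (- x) (lexx 0) adm.
  rewrite sub0r opprK in adm'.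
  have K0 : {ae P, forall w, 0 <= rightlim (alpha.2^~ w) 0 + - x}.
    apply: aeW => w; rewrite subr_ge0 (le_trans (ltW x0))//.
    rewrite -[X in X <= _](injection_le0 adm w (lexx 0)).
    by apply: rightlim_ge; exact: (injection_nondecreasing adm).
  have := reward_shift (lexx 0) adm K0; rewrite sub0r opprK mulrN opprK => <-.
  by apply: ereal_sup_ubound; exists (shift_injection (- x) alpha).
apply: ge_ereal_sup => _ [alpha adm <-]; rewrite le_max.
have [K0|K0] := initial_injection_zero_one adm; last first.
  by rewrite reward_immediate// ltW.
have adm' := shift_admissible x (ltW x0) adm; rewrite subrr in adm'.
have := reward_shift (ltW x0) adm K0; rewrite subrr => rE.
apply/orP; right; rewrite -leeBlDr// -EFinN -rE.
by apply: ereal_sup_ubound; exists (shift_injection x alpha).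
Qed.

End controlled_reserve.

(** * The value function below zero *)

Theorem mainTheorem5 (R : realType) (d : measure_display)
    (Omega : measurableType d) (P : probability Omega R)
    (Ft : R -> set (set Omega))
    (c a b eta rho delta : R) (f F : R -> R) (x y : R)
    (N : R -> Omega -> nat) (lam : R -> Omega -> R) (Y : nat -> {RV P >-> R})
    (hFt : complete_right_continuous_filtration P Ft)
    (hF0 : forall A, Ft 0 A -> (P A = 0 \/ P A = 1)%E)
    (hc : 0 < c) (ha : 0 < a) (hb : 0 < b) (heta : 0 < eta) (hrho : 0 < rho)
    (hdelta : 1 < delta)
    (hN : hawkes_process P Ft a b eta y N lam)
    (hY : claim_sizes f F N Y)
    (hR : adapted Ft (uncontrolled_surplus c N Y 0))
    (hx : x < 0) (hy : b <= y) :
  let v := value_function Ft c rho delta N Y in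
  let kappa := kappa_star Ft c rho delta N Y in
  ((x%:E < kappa)%E -> v x = 0%E) /\
  ((kappa < x%:E)%E -> v x = (v 0%R + (delta * x)%R%:E)%E).
Proof.
have delta0 : 0 < delta by rewrite (lt_trans ltr01).
have vx := value_lt0 hFt hc hrho delta0 (hawkes_counting hN) (claim_positive hY) hR hF0 hx.
rewrite /kappa_star; cbv zeta; rewrite vx.
case: (value_function Ft c rho delta N Y 0) => [v0| |] /=; split.
- rewrite !lte_fin ltrNr ltr_pdivrMr// => xv; apply: max_l.
  by rewrite -EFinD lee_fin; nra.
- rewrite !lte_fin ltrNl ltr_pdivlMr// => xv; apply: max_r.
  by rewrite -EFinD lee_fin; nra.
- by rewrite gt0_mulye ?lte_fin ?invr_gt0.
- by rewrite maxey.
- by rewrite maxeNy.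
- by rewrite gt0_mulNye ?lte_fin ?invr_gt0.
Qed.
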